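(* Let $f_1,\dots,f_n:\mathbb{R}^d\to\mathbb{R}$ be twice continuously differentiable functions such that for each $i$ there are constants $0\le\mu_i\le L_i$ with $\mu_i I\preceq\nabla^2 f_i(y)\preceq L_i I$ for every $y\in\mathbb{R}^d$, and assume $\mu:=\sum_{i=1}^n\mu_i>0$. Let $y^*$ be the minimizer of $f=\sum_{j=1}^n f_j$ over $\mathbb{R}^d$ and let $x^*=(y^*,\dots,y^* )\in\mathbb{R}^{nd}$. For every $k=0,1,2,\dots$ let $G^k=(\{1,\dots,n\},E_k)$ be a directed graph and let $W^k=[w^k_{ij}]$ be an $n\times n$ doubly stochastic matrix with $w^k_{ij}=0$ whenever $i\neq j$ and $(i,j)\notin E_k$. Assume that there is a positive integer $m$ such that $$\sup_{k\ge m-1}\nu_{\max}\Big(W^kW^{k-1}\cdots W^{k-m+1}-\tfrac1n ee^T\Big)<1 .$$ Let $\mathcal{W}^k=W^k\otimes I_d$, and let the matrices $B^k\in\mathbb{R}^{nd\times nd}$ be given by one of the following three choices: $B^k=b\,\mathcal{W}^k$ for all $k$, or $B^k=bI$ for all $k$, where $b>0$ is a constant (independent of the step-sizes), or $B^k=0$ for all $k$. Then there exist $0<d_{\min}<d_{\max}$ such that, for all step-sizes $d_i^k$ satisfying $d_{\min}\le d_i^k\le d_{\max}$ for all $i=1,\dots,n$ and all $k\ge 0$, and for every $x^0\in\mathbb{R}^{nd}$, the sequence $\{x^k\}$ generated from $x^0$ and $u^0=0\in\mathbb{R}^{nd}$ by $$\begin{cases}x^{k+1}=\mathcal{W}^kx^k-D^k\big(u^k+\nabla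 F(x^k)\big)\\ u^{k+1}=u^k+(\mathcal{W}^k-I)\big(\nabla F(x^k)+u^k-B^kx^k\big)\end{cases}\qquad k=0,1,2,\dots$$ where $D^k=\mathrm{diag}(d_1^kI_d,\dots,d_n^kI_d)$, converges R-linearly to $x^*$.
   Context: For $x=(x_1,\dots,x_n)\in\mathbb{R}^{nd}$ with blocks $x_i\in\mathbb{R}^d$, $F(x)=\sum_{j=1}^n f_j(x_j)$. The vector $e\in\mathbb{R}^n$ has all components equal to $1$, and $\nu_{\max}(A)$ denotes the largest singular value of a matrix $A$. $A\preceq B$ means that $B-A$ is positive semidefinite. A doubly stochastic matrix has nonnegative entries and all its row sums and column sums equal $1$. A sequence $\{x^k\}$ converges R-linearly to $x^*$ if there exist $c\geq 0$ and $\lambda\in(0,1)$ such that $\|x^k-x^*\|\le c\lambda^k$ for all $k$. *)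

(* Defs.v *)
From HB Require Import structures.
From mathcomp Require Import all_boot all_order all_algebra.
From mathcomp Require Import all_classical all_reals all_analysis.
From mathcomp.real_closed Require Export mxtens.

Set Implicit Arguments.
Unset Strict Implicit.
Unset Printing Implicit Defensive.

Import Order.TTheory GRing.Theory Num.Theory.
Import numFieldNormedType.Exports.

Local Open Scope classical_set_scope.
Local Open Scope ring_scope.

(* The library's norm on matrices is the max norm, so the Euclidean norm is
   spelled out. *)
Definition enorm (R : realType) (p : nat) (v : 'cV[R]_p) : R :=
  Num.sqrt (\sum_(i < p) v i 0 ^+ 2).

Definition psdmx (R : realType) (p : nat) (A : 'M[R]_p) : Prop :=
  A^T = A /\ forall v : 'cV[R]_p, 0 <= (v^T *m A *m v) 0 0.

Definition loewner_le (R : realType) (p : nat) (A B : 'M[R]_p) : Prop :=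
  psdmx (B - A).

Definition singular_value (R : realType) (p q : nat) (A : 'M[R]_(p, q)) (s : R) :
  Prop := 0 <= s /\ eigenvalue (A^T *m A) (s ^+ 2).

(* The set of singular values is finite, and nonempty when 0 < q; the supremum
   is then the largest one. *)
Definition nu_max (R : realType) (p q : nat) (A : 'M[R]_(p, q)) : R :=
  sup [set s | singular_value A s].

Definition doubly_stochastic (R : realType) (p : nat) (A : 'M[R]_p) : Prop :=
  [/\ forall i j, 0 <= A i j,
      forall i, \sum_j A i j = 1 &
      forall j, \sum_i A i j = 1].

Definition grad (R : realType) (p : nat) (g : 'cV[R]_p -> R) (y : 'cV[R]_p) :
  'cV[R]_p := \col_i 'D_(delta_mx i 0) g y.

Definition hess (R : realType) (p : nat) (g : 'cV[R]_p -> R) (y : 'cV[R]_p) :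
  'M[R]_p :=
  \matrix_(i, j) 'D_(delta_mx i 0) (fun z => 'D_(delta_mx j 0) g z) y.

Definition twice_cont_diff (R : realType) (p : nat) (g : 'cV[R]_p -> R) : Prop :=
  [/\ forall y, differentiable g y,
      forall y, differentiable (grad g) y &
      continuous (hess g)].

(* R^{nd} is 'cV_(n * d) with the index convention of the Kronecker product:
   component (i, j) has index mxtens_index (i, j) = i * d + j. *)
Definition block (R : realType) (n d : nat) (x : 'cV[R]_(n * d)) (i : 'I_n) :
  'cV[R]_d := \col_j x (mxtens_index (i, j)) 0.

Definition stack (R : realType) (n d : nat) (X : 'I_n -> 'cV[R]_d) :
  'cV[R]_(n * d) :=
  \col_l X (mxtens_unindex l).1 (mxtens_unindex l).2 0.

Definition separable_sum (R : realType) (n d : nat) (f : 'I_n -> 'cV[R]_d -> R)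
  (x : 'cV[R]_(n * d)) : R := \sum_(j < n) f j (block x j).

Definition kron_id (R : realType) (n d : nat) (A : 'M[R]_n) : 'M[R]_(n * d) :=
  tensmx A (1%:M : 'M[R]_d).

(* diag(s_1 I_d, ..., s_n I_d) *)
Definition step_mx (R : realType) (n d : nat) (s : 'I_n -> R) : 'M[R]_(n * d) :=
  kron_id d (diag_mx (\row_i s i)).

(* W^k W^{k-1} ... W^{k-m+1}, newest factor leftmost; meant for m <= k.+1 since
   the subtraction truncates. *)
Definition window_prod (R : realType) (n : nat) (W : nat -> 'M[R]_n) (m k : nat) :
  'M[R]_n := \big[mulmx/1%:M]_(i < m) W (k - i)%N.

(* e e^T / n *)
Definition avg_mx (R : realType) (n : nat) : 'M[R]_n :=
  n%:R^-1 *: ((const_mx 1 : 'cV[R]_n) *m (const_mx 1 : 'cV[R]_n)^T).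

Definition R_linear_cvg (R : realType) (p : nat) (x : nat -> 'cV[R]_p)
  (xs : 'cV[R]_p) : Prop :=
  exists c lambda : R, [/\ 0 <= c, 0 < lambda < 1 &
    forall k, enorm (x k - xs) <= c * lambda ^+ k].

(* Main.v *)
(* With Y^k = u^k + grad F(x^k), and iterates written as n x d matrices, the
   method is gradient tracking: J Y^k = J grad F(x^k) for J = e e^T / n, because
   J u^k is preserved. The consensus error x - J x and the tracking error
   Y - J Y are mixed by W^k, which contracts a time-varying norm built from the
   windows of length m; since (W^k - I) B^k J = 0, the term B^k x only feeds the
   consensus error into the tracking error. The mean J x performs an inexact
   gradient step on the strongly convex sum of the f_i. All the other couplings
   are of the order of the step-size or of the relative spread of the steps, so
   for small step-sizes in a short interval a weighted sum of the three errors
   decreases geometrically. *)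

Require Import Defs.
From HB Require Import structures.
From mathcomp Require Import all_boot all_order all_algebra.
From mathcomp Require Import all_classical all_reals all_analysis.
From mathcomp Require Import ring lra.

Set Implicit Arguments.
Unset Strict Implicit.
Unset Printing Implicit Defensive.

Import Order.TTheory GRing.Theory Num.Theory.
Import numFieldNormedType.Exports.

Local Open Scope classical_set_scope.
Local Open Scope ring_scope.

(** * Frobenius norm and positive semidefinite forms *)

(** The quadratic is evaluated at its vertex [- b / c]; if [c = 0], a nonzero slope would make it
    take the value [-1]. Both Cauchy-Schwarz inequalities below rest on this. *)
Lemma discriminant_le (R : realFieldType) (a b c : R) :
  0 <= a -> 0 <= c -> (forall t : R, 0 <= a + 2 * b * t + c * t ^+ 2) ->
  b ^+ 2 <= a * c.
Proof.
move=> a0 c0 H.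
have [c_eq|c_neq] := eqVneq c 0.
  have [b_eq|b_neq] := eqVneq b 0; first by rewrite b_eq c_eq expr0n mulr0.
  have := H (- (a + 1) / (2 * b)); rewrite c_eq.
  have -> : a + 2 * b * (- (a + 1) / (2 * b)) + 0 * (- (a + 1) / (2 * b)) ^+ 2
            = -1 by field.
  by move=> ?; exfalso; lra.
have cp : 0 < c by rewrite lt0r c_neq.
have := H (- b / c).
have -> : a + 2 * b * (- b / c) + c * (- b / c) ^+ 2 = (a * c - b ^+ 2) / c.
  by field.
by rewrite pmulr_lge0 ?invr_gt0// subr_ge0.
Qed.

Section Frobenius.
Variable R : realType.

(** The Frobenius inner product, which is the Euclidean one on columns, so that vectors, blocks and
    whole iterates share one norm. *)
Definition fdot p q (A B : 'M[R]_(p, q)) : R := \tr (A^T *m B).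

Definition fnorm p q (A : 'M[R]_(p, q)) : R := Num.sqrt (fdot A A).

Lemma fdotE p q (A B : 'M[R]_(p, q)) : fdot A B = \sum_j \sum_i A i j * B i j.
Proof.
by apply: eq_bigr => j _; rewrite mxE; apply: eq_bigr => i _; rewrite mxE.
Qed.

Lemma fdotC p q (A B : 'M[R]_(p, q)) : fdot A B = fdot B A.
Proof. by rewrite /fdot -mxtrace_tr trmx_mul trmxK. Qed.

Lemma fdotDr p q (A B C : 'M[R]_(p, q)) : fdot A (B + C) = fdot A B + fdot A C.
Proof. by rewrite /fdot mulmxDr raddfD. Qed.

Lemma fdotZr p q (A B : 'M[R]_(p, q)) t : fdot A (t *: B) = t * fdot A B.
Proof. by rewrite /fdot -scalemxAr mxtraceZ. Qed.

Lemma fdotBr p q (A B C : 'M[R]_(p, q)) : fdot A (B - C) = fdot A B - fdot A C.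
Proof. by rewrite /fdot mulmxBr raddfB. Qed.

Lemma fdotDl p q (A B C : 'M[R]_(p, q)) : fdot (B + C) A = fdot B A + fdot C A.
Proof. by rewrite fdotC fdotDr !(fdotC A). Qed.

Lemma fdotZl p q (A B : 'M[R]_(p, q)) t : fdot (t *: B) A = t * fdot B A.
Proof. by rewrite fdotC fdotZr fdotC. Qed.

Lemma fdot_ge0 p q (A : 'M[R]_(p, q)) : 0 <= fdot A A.
Proof.
by rewrite fdotE; apply: sumr_ge0 => j _; apply: sumr_ge0 => i _;
  rewrite -expr2 sqr_ge0.
Qed.

Lemma fdot_cols p q (A B : 'M[R]_(p, q)) :
  fdot A B = \sum_j fdot (col j A) (col j B).
Proof.
rewrite fdotE; apply: eq_bigr => j _; rewrite fdotE big_ord1.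
by apply: eq_bigr => i _; rewrite !mxE.
Qed.

Lemma fdot_tr p q (A B : 'M[R]_(p, q)) : fdot A^T B^T = fdot A B.
Proof. by rewrite /fdot trmxK mxtrace_mulC -mxtrace_tr trmx_mul trmxK. Qed.

Lemma fdot_form p (A : 'M[R]_p) (u v : 'cV[R]_p) :
  fdot u (A *m v) = (u^T *m A *m v) 0 0.
Proof. by rewrite /fdot mulmxA trace_mx11. Qed.

Lemma fdot_eq0 p q (A : 'M[R]_(p, q)) : (fdot A A == 0) = (A == 0).
Proof.
apply/idP/eqP => [|->]; last by rewrite /fdot mulmx0 mxtrace0.
rewrite fdotE psumr_eq0 => [/allP H|j _]; last first.
  by apply: sumr_ge0 => i _; rewrite -expr2 sqr_ge0.
apply/matrixP => i j; rewrite mxE.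
have /= := H j (mem_index_enum _); rewrite psumr_eq0 => [/allP H2|k _]; last first.
  by rewrite -expr2 sqr_ge0.
by apply/eqP; have /= := H2 i (mem_index_enum _); rewrite mulf_eq0 orbb.
Qed.

Lemma fdot_CS p q (A B : 'M[R]_(p, q)) :
  fdot A B ^+ 2 <= fdot A A * fdot B B.
Proof.
apply: discriminant_le; rewrite ?fdot_ge0// => t.
have := fdot_ge0 (A + t *: B).
rewrite fdotDr !fdotDl !fdotZr !fdotZl (fdotC B A).
by congr (0 <= _); ring.
Qed.

Lemma fnorm_ge0 p q (A : 'M[R]_(p, q)) : 0 <= fnorm A.
Proof. exact: sqrtr_ge0. Qed.

Lemma fnorm_sq p q (A : 'M[R]_(p, q)) : fnorm A ^+ 2 = fdot A A.
Proof. by rewrite sqr_sqrtr// fdot_ge0. Qed.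

Lemma fdot_le p q (A B : 'M[R]_(p, q)) : fdot A B <= fnorm A * fnorm B.
Proof.
apply: le_trans (ler_norm _) _.
rewrite -ler_sqr ?nnegrE ?mulr_ge0 ?fnorm_ge0//.
by rewrite exprMn !fnorm_sq real_normK ?num_real// fdot_CS.
Qed.

Lemma fnormD p q (A B : 'M[R]_(p, q)) : fnorm (A + B) <= fnorm A + fnorm B.
Proof.
rewrite -ler_sqr ?nnegrE ?addr_ge0 ?fnorm_ge0//.
rewrite fnorm_sq fdotDr !fdotDl (fdotC B A) sqrrD !fnorm_sq.
by have := fdot_le A B; rewrite -mulr_natl; lra.
Qed.

Lemma fnormZ p q (A : 'M[R]_(p, q)) t : fnorm (t *: A) = `|t| * fnorm A.
Proof.
by rewrite /fnorm fdotZr fdotZl mulrA -expr2 sqrtrM ?sqr_ge0// sqrtr_sqr.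
Qed.

Lemma fnormN p q (A : 'M[R]_(p, q)) : fnorm (- A) = fnorm A.
Proof. by rewrite -scaleN1r fnormZ normrN1 mul1r. Qed.

Lemma fnormB p q (A B : 'M[R]_(p, q)) : fnorm (A - B) <= fnorm A + fnorm B.
Proof. by rewrite (le_trans (fnormD _ _))// fnormN. Qed.

Lemma fnorm0 p q : fnorm (0 : 'M[R]_(p, q)) = 0.
Proof. by rewrite -(scale0r (0 : 'M[R]_(p, q))) fnormZ normr0 mul0r. Qed.

Lemma fnorm_le_sq p q p' q' (A : 'M[R]_(p, q)) (B : 'M[R]_(p', q')) c :
  0 <= c -> (fnorm A <= c * fnorm B) = (fdot A A <= c ^+ 2 * fdot B B).
Proof.
move=> c0; rewrite -ler_sqr ?nnegrE ?mulr_ge0 ?fnorm_ge0//.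
by rewrite exprMn !fnorm_sq.
Qed.

(** The squared norm is the sum over the columns, and [A] acts on each column separately. *)
Lemma fnorm_mulmx_le p (A : 'M[R]_p) q (X : 'M[R]_(p, q)) c : 0 <= c ->
  (forall v : 'cV[R]_p, fnorm (A *m v) <= c * fnorm v) ->
  fnorm (A *m X) <= c * fnorm X.
Proof.
move=> c0 H; rewrite fnorm_le_sq// fdot_cols (fdot_cols X X) mulr_sumr.
by apply: ler_sum => j _; rewrite -fnorm_le_sq// colE -mulmxA -colE H.
Qed.

Lemma fnorm_rows_le p q (A B : 'M[R]_(p, q)) c : 0 <= c ->
  (forall i, fnorm (row i A) <= c * fnorm (row i B)) -> fnorm A <= c * fnorm B.
Proof.
move=> c0 H; rewrite fnorm_le_sq// -(fdot_tr A) -(fdot_tr B).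
rewrite fdot_cols (fdot_cols B^T) mulr_sumr; apply: ler_sum => i _.
by rewrite -!tr_row !fdot_tr -fnorm_le_sq.
Qed.

End Frobenius.

Section Psd.
Variables (R : realType) (p : nat).
Implicit Types (P : 'M[R]_p) (u v : 'cV[R]_p).

Lemma psdmx_ge0 P v : psdmx P -> 0 <= fdot v (P *m v).
Proof. by case=> _ /(_ v); rewrite fdot_form. Qed.

Lemma psdmx_sym P u v : psdmx P -> fdot u (P *m v) = fdot v (P *m u).
Proof.
by case=> symP _; rewrite /fdot -mxtrace_tr !trmx_mul trmxK symP mulmxA.
Qed.

Lemma psdmx_CS P u v : psdmx P ->
  fdot u (P *m v) ^+ 2 <= fdot u (P *m u) * fdot v (P *m v).
Proof.
move=> psdP; apply: discriminant_le; rewrite ?psdmx_ge0// => t.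
have := psdmx_ge0 (u + t *: v) psdP.
rewrite mulmxDr -scalemxAr fdotDr !fdotDl !fdotZr !fdotZl (psdmx_sym v u psdP).
by congr (0 <= _); ring.
Qed.

Lemma psdmx_le_fdot P c u v : 0 <= c -> psdmx P -> psdmx (c%:M - P) ->
  fdot u (P *m v) <= c * (fnorm u * fnorm v).
Proof.
move=> c0 psdP psdc.
have bnd (w : 'cV[R]_p) : fdot w (P *m w) <= c * fnorm w ^+ 2.
  have := psdmx_ge0 w psdc.
  rewrite mulmxBl mul_scalar_mx fnorm_sq fdotBr fdotZr.
  by lra.
apply: le_trans (ler_norm _) _.
rewrite -ler_sqr ?nnegrE ?mulr_ge0 ?fnorm_ge0//.
rewrite real_normK ?num_real//; apply: le_trans (psdmx_CS u v psdP) _.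
have -> : (c * (fnorm u * fnorm v)) ^+ 2
        = (c * fnorm u ^+ 2) * (c * fnorm v ^+ 2) by ring.
by apply: ler_pM; rewrite ?psdmx_ge0.
Qed.

End Psd.
(** * Largest singular value *)

Section SingularValues.
Variable R : realType.

Lemma fnorm_mulmx p q r (A : 'M[R]_(p, q)) (B : 'M[R]_(q, r)) :
  fnorm (A *m B) <= fnorm A * fnorm B.
Proof.
have rowsq s t (C : 'M[R]_(s, t)) : fdot C C = \sum_i fdot (row i C) (row i C).
  by rewrite -fdot_tr fdot_cols; apply: eq_bigr => i _; rewrite -tr_row fdot_tr.
rewrite -ler_sqr ?nnegrE ?mulr_ge0 ?fnorm_ge0// exprMn !fnorm_sq.
rewrite (rowsq _ _ A) mulr_suml rowsq; apply: ler_sum => i _.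
rewrite row_mul fdotE (fdot_cols B B) mulr_sumr; apply: ler_sum => j _.
rewrite big_ord1 -expr2.
have -> : (row i A *m B) 0 j = fdot (row i A)^T (col j B).
  rewrite !mxE fdotE big_ord1; apply: eq_bigr => k _.
  by rewrite !mxE.
by rewrite -[in leRHS](fdot_tr (row i A)) fdot_CS.
Qed.

(* The supremum [lam] of the Rayleigh quotient of [A^T A] is an eigenvalue:
   [P = lam - A^T A] is positive semidefinite, and if it were invertible, then
   the Cauchy-Schwarz inequality for [P] would keep the quotient a positive
   distance [1 / |P^-1|] below [lam]. *)
Lemma fnorm_nu_max p (A : 'M[R]_p) (v : 'cV[R]_p) :
  fnorm (A *m v) <= nu_max A * fnorm v.
Proof.
have [->|v_neq0] := eqVneq v 0; first by rewrite mulmx0 !fnorm0 mulr0.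
pose M := A^T *m A.
have fM (w : 'cV[R]_p) : fdot w (M *m w) = fnorm (A *m w) ^+ 2.
  by rewrite fnorm_sq /M /fdot trmx_mul !mulmxA.
pose S := [set t | exists w : 'cV[R]_p, fnorm w = 1 /\ t = fnorm (A *m w) ^+ 2].
have fv0 : 0 < fnorm v.
  by rewrite lt0r fnorm_ge0 andbT -sqrf_eq0 fnorm_sq fdot_eq0.
have scaled (w : 'cV[R]_p) : 0 < fnorm w -> fnorm ((fnorm w)^-1 *: w) = 1.
  by move=> w0; rewrite fnormZ ger0_norm ?invr_ge0 ?fnorm_ge0// mulVf// gt_eqF.
have S_nonempty : S !=set0.
  by exists (fnorm (A *m ((fnorm v)^-1 *: v)) ^+ 2), ((fnorm v)^-1 *: v);
    rewrite scaled.
have S_bounded : has_ubound S.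
  exists (fnorm A ^+ 2) => _ [w [w1 ->]].
  rewrite ler_sqr ?nnegrE ?fnorm_ge0//.
  by rewrite (le_trans (fnorm_mulmx _ _))// w1 mulr1.
set lam := sup S.
have lam_ub (w : 'cV[R]_p) : fnorm (A *m w) ^+ 2 <= lam * fnorm w ^+ 2.
  have [->|w0] := eqVneq w 0; first by rewrite mulmx0 !fnorm0 expr0n mulr0.
  have fw0 : 0 < fnorm w.
    by rewrite lt0r fnorm_ge0 andbT -sqrf_eq0 fnorm_sq fdot_eq0.
  have : fnorm (A *m ((fnorm w)^-1 *: w)) ^+ 2 <= lam.
    by apply: ub_le_sup => //; exists ((fnorm w)^-1 *: w); rewrite scaled.
  rewrite -scalemxAr fnormZ ger0_norm ?invr_ge0 ?fnorm_ge0// exprMn exprVn.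
  by rewrite mulrC ler_pdivrMr// exprn_gt0.
have lam_ge0 : 0 <= lam.
  have := le_trans (sqr_ge0 _) (lam_ub v).
  by rewrite pmulr_lge0// exprn_gt0.
pose P := lam%:M - M.
have fP (w : 'cV[R]_p) :
    fdot w (P *m w) = lam * fnorm w ^+ 2 - fnorm (A *m w) ^+ 2.
  by rewrite mulmxBl mul_scalar_mx fdotBr fdotZr fM -fnorm_sq.
have psdP : psdmx P.
  split=> [|w]; last by rewrite -fdot_form fP subr_ge0.
  by rewrite /P linearB /= tr_scalar_mx /M trmx_mul trmxK.
have P_sing : P \notin unitmx.
  apply/negP => P_unit; pose Q := invmx P.
  have gap (w : 'cV[R]_p) : fnorm w = 1 -> 1 <= fdot w (P *m w) * fnorm Q.
    move=> w1; have := psdmx_CS w (Q *m w) psdP.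
    rewrite mulmxA mulmxV// mul1mx -fnorm_sq w1 !expr1n => /le_trans; apply.
    apply: ler_wpM2l; first exact: psdmx_ge0.
    apply: le_trans (fdot_le _ _) _; rewrite w1 mulr1.
    by rewrite (le_trans (fnorm_mulmx _ _))// w1 mulr1.
  have [_ [w [w1 _]]] := S_nonempty.
  have Q0 : 0 < fnorm Q.
    rewrite lt0r fnorm_ge0 andbT; apply: contraTneq (gap w w1) => ->.
    by rewrite mulr0 ler10.
  have : lam <= lam - (fnorm Q)^-1.
    apply: ge_sup => // _ [z [z1 ->]].
    have := gap z z1; rewrite -ler_pdivrMr// fP z1 expr1n mulr1 div1r.
    by lra.
  by move: (Q0); rewrite -invr_gt0; lra.
have lam_sv : singular_value A (Num.sqrt lam).
  split; first exact: sqrtr_ge0.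
  rewrite sqr_sqrtr// /eigenvalue /eigenspace kermx_eq0 row_free_unit.
  by rewrite -/M -opprB -/P -scaleN1r unitmxZ// unitrN1.
(* Boundedness is what lets [nu_max], a real supremum, dominate [Num.sqrt lam]. Eigenvectors are
   rows here, hence the transposes. *)
have sv_bounded : has_ubound [set s | singular_value A s].
  exists (Num.sqrt lam) => s [s0 /eigenvalueP[w wM w0]].
  rewrite -[s]ger0_norm// -sqrtr_sqr ler_wsqrtr//.
  have w_gt0 : 0 < fnorm w^T ^+ 2.
    by rewrite fnorm_sq fdot_tr lt0r fdot_eq0 w0 fdot_ge0.
  have := lam_ub w^T; rewrite -fM.
  have -> : M *m w^T = s ^+ 2 *: w^T.
    have symM : M^T = M by rewrite /M trmx_mul trmxK.
    by rewrite -[M]symM -trmx_mul wM linearZ.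
  by rewrite fdotZr -fnorm_sq ler_pM2r.
have lam_le : Num.sqrt lam <= nu_max A by exact: ub_le_sup.
apply: le_trans (_ : Num.sqrt lam * fnorm v <= _); last first.
  by rewrite ler_wpM2r ?fnorm_ge0.
rewrite -ler_sqr ?nnegrE ?mulr_ge0 ?fnorm_ge0 ?sqrtr_ge0//.
by rewrite exprMn (sqr_sqrtr lam_ge0) lam_ub.
Qed.

End SingularValues.
(** * Gradients with bounded Hessians *)

Section Gradients.
Variable R : realType.

Lemma is_derive_line (V W : normedModType R) (F : V -> W) (z v : V) (t : R)
    (D : W) : is_derive (t *: v + z) v F D ->
  is_derive t 1 (fun s : R => F (s *: v + z)) D.
Proof.
have quotE : (fun h : R => h^-1 *: (((fun s : R => F (s *: v + z)) \o shift t)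
      (h *: (1 : R)) - F (t *: v + z)))
    = (fun h : R => h^-1 *: ((F \o shift (t *: v + z)) (h *: v) - F (t *: v + z))).
  apply/funext => h /=; congr (_ *: (F _ - _)).
  by rewrite addrA -scalerDl /GRing.scale/= mulr1.
by case=> dF <-; apply: DeriveDef; rewrite /derivable /derive quotE.
Qed.

Lemma is_derive_fdot (V : normedModType R) p (G : V -> 'cV[R]_p) (x v : V)
    (w D : 'cV[R]_p) : is_derive x v G D ->
  is_derive x v (fun y => fdot w (G y)) (fdot w D).
Proof.
case=> dG <-.
have -> : (fun y => fdot w (G y)) = \sum_i (w i 0 *: (fun y => G y i 0)).
  apply/funext => y; rewrite fct_sumE fdotE big_ord1.
  by apply: eq_bigr.
have -> : fdot w ('D_v G x) = \sum_i w i 0 *: 'D_v (fun y => G y i 0) x.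
  rewrite fdotE big_ord1; apply: eq_bigr => i _.
  by rewrite derive_mx// mxE.
apply: is_derive_sum => i; apply: is_deriveZ.
by apply: derivableP; move/derivable_mxP : dG; apply.
Qed.

(* The mean value theorem is applied to [<w, G>] along the segment, where [w]
   is the increment of [G] itself. *)
Lemma lipschitz_of_derive p (G : 'cV[R]_p -> 'cV[R]_p) (P : 'cV[R]_p -> 'M[R]_p)
    c : 0 <= c -> (forall y v, is_derive y v G (P y *m v)) ->
  (forall y, psdmx (P y)) -> (forall y, loewner_le (P y) c%:M) ->
  forall y z, fnorm (G y - G z) <= c * fnorm (y - z).
Proof.
move=> c0 dG psdP psdc y z.
set w := G y - G z; set v := y - z.
pose h (s : R) := fdot w (G (s *: v + z)).
have dh (t : R) : is_derive t 1 h (fdot w (P (t *: v + z) *m v)).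
  apply: (is_derive_line (F := fun y => fdot w (G y))).
  exact: is_derive_fdot.
have hcont : {within `[0, 1], continuous h}.
  by apply: derivable_within_continuous => t _; exact: ex_derive.
have [t _] := MVT ltr01 (fun t _ => dh t) hcont.
rewrite subr0 mulr1 /h scale1r scale0r add0r /v subrK.
rewrite -fdotBr -/w -/v => E.
have := psdmx_le_fdot w v c0 (psdP (t *: v + z)) (psdc (t *: v + z)).
rewrite -E -fnorm_sq.
have [->|w0] := eqVneq (fnorm w) 0; first by rewrite mulr_ge0 ?fnorm_ge0.
have w_gt0 : 0 < fnorm w by rewrite lt0r w0 fnorm_ge0.
by rewrite expr2 mulrCA ler_pM2l.
Qed.

(** The transpose appears because the row index of [hess] is the direction of the outer derivative
    and its column index the component of the gradient. *)
Lemma is_derive_grad p (g : 'cV[R]_p -> R) (y v : 'cV[R]_p) :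
  differentiable (grad g) y -> is_derive y v (grad g) ((hess g y)^T *m v).
Proof.
move=> dg; apply: DeriveDef; first exact: diff_derivable.
rewrite deriveE// {1}(matrix_sum_delta v) linear_sum.
apply/matrixP => i j; rewrite ord1 [RHS]mxE summxE; apply: eq_bigr => k _.
rewrite big_ord1 linearZ mxE -deriveE// derive_mx; last exact: diff_derivable.
rewrite mxE [(hess g y)^T _ _]mxE [hess g y _ _]mxE mulrC.
suff -> : (fun t => grad g t i 0) = (fun z => 'D_(delta_mx i 0) g z) by [].
by apply/funext => x; rewrite mxE.
Qed.

(** Symmetry is part of [psdmx], so it is read off the Loewner bound rather than from Schwarz's
    theorem. *)
Lemma hess_sym p (g : 'cV[R]_p -> R) y a :
  loewner_le a%:M (hess g y) -> (hess g y)^T = hess g y.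
Proof. by case; rewrite linearB /= tr_scalar_mx => /addIr. Qed.

Lemma loewner_le_fdot p (A B : 'M[R]_p) (v : 'cV[R]_p) : loewner_le A B ->
  fdot v (A *m v) <= fdot v (B *m v).
Proof.
by move/(psdmx_ge0 v); rewrite mulmxBl fdotBr subr_ge0.
Qed.

Lemma fdot_scalar_mx p (a : R) (v : 'cV[R]_p) :
  fdot v (a%:M *m v) = a * fdot v v.
Proof. by rewrite mul_scalar_mx fdotZr. Qed.

Lemma grad_lipschitz p (g : 'cV[R]_p -> R) a c : 0 <= a <= c ->
  (forall y, differentiable (grad g) y) ->
  (forall y, loewner_le a%:M (hess g y) /\ loewner_le (hess g y) c%:M) ->
  forall y z, fnorm (grad g y - grad g z) <= c * fnorm (y - z).
Proof.
move=> /andP[a0 ac] dg Hg; apply: (lipschitz_of_derive (P := hess g)).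
- exact: le_trans ac.
- move=> y v; have [/hess_sym symH _] := Hg y.
  by rewrite -symH; exact: is_derive_grad.
- move=> y; have [H1 _] := Hg y; split=> [|v]; first exact: hess_sym H1.
  rewrite -fdot_form (le_trans _ (loewner_le_fdot v H1))//.
  by rewrite fdot_scalar_mx mulr_ge0 ?fdot_ge0.
- by move=> y; have [] := Hg y.
Qed.

Lemma fdot_sum_mulmx p n (A : 'I_n -> 'M[R]_p) (v : 'cV[R]_p) :
  fdot v ((\sum_i A i) *m v) = \sum_i fdot v (A i *m v).
Proof. by rewrite mulmx_suml /fdot mulmx_sumr raddf_sum. Qed.

(** The derivative [P y] of the gradient step lies between [0] and [1 - a * \sum_i mu i] in the
    Loewner order: the upper Hessian bounds give the first inequality, the lower ones the second. *)
Lemma gradient_step_contraction p n (f : 'I_n -> 'cV[R]_p -> R)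
    (mu L : 'I_n -> R) a :
  (forall i y, differentiable (grad (f i)) y) ->
  (forall i y, loewner_le (mu i)%:M (hess (f i) y) /\
               loewner_le (hess (f i) y) (L i)%:M) ->
  0 <= a -> a * \sum_i L i <= 1 -> 0 <= 1 - a * \sum_i mu i ->
  forall y z, fnorm ((y - a *: \sum_i grad (f i) y) -
                     (z - a *: \sum_i grad (f i) z))
              <= (1 - a * \sum_i mu i) * fnorm (y - z).
Proof.
move=> dg Hg a0 aL amu.
pose P y : 'M[R]_p := 1%:M - a *: \sum_i hess (f i) y.
have PE y (v : 'cV[R]_p) : fdot v (P y *m v)
    = fdot v v - a * \sum_i fdot v (hess (f i) y *m v).
  by rewrite mulmxBl mul1mx -scalemxAl fdotBr fdotZr fdot_sum_mulmx.
have symP y : (P y)^T = P y.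
  rewrite /P linearB /= trmx1 linearZ /= linear_sum /=; congr (_ - _ *: _).
  by apply: eq_bigr => i _; have [/hess_sym] := Hg i y.
apply: (lipschitz_of_derive (G := fun y => y - a *: \sum_i grad (f i) y) (P := P)).
- by [].
- move=> y v; rewrite mulmxBl mul1mx -scalemxAl mulmx_suml.
  have -> : (fun y => y - a *: \sum_i grad (f i) y)
          = id - a *: \sum_i grad (f i).
    apply/funext => x; rewrite -[RHS]/(x - a *: (\sum_i grad (f i)) x).
    by rewrite fct_sumE.
  apply: is_deriveB; apply: is_deriveZ; apply: is_derive_sum => i.
  have [/hess_sym symH _] := Hg i y.
  by rewrite -symH; exact: is_derive_grad.
- move=> y; split=> [|v]; first exact: symP.
  rewrite -fdot_form PE subr_ge0.
  have : \sum_i fdot v (hess (f i) y *m v) <= (\sum_i L i) * fdot v v.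
    rewrite mulr_suml; apply: ler_sum => i _; have [_ H2] := Hg i y.
    by rewrite (le_trans (loewner_le_fdot v H2))// fdot_scalar_mx.
  move/(ler_wpM2l a0)/le_trans; apply.
  by rewrite mulrA ler_piMl ?fdot_ge0.
- move=> y; split=> [|v]; first by rewrite linearB /= tr_scalar_mx symP.
  rewrite -fdot_form mulmxBl fdotBr PE fdot_scalar_mx.
  have : (\sum_i mu i) * fdot v v <= \sum_i fdot v (hess (f i) y *m v).
    rewrite mulr_suml; apply: ler_sum => i _; have [H1 _] := Hg i y.
    by rewrite (le_trans _ (loewner_le_fdot v H1))// fdot_scalar_mx.
  by move/(ler_wpM2l a0); rewrite mulrA; lra.
Qed.

(** Fermat's rule along each coordinate line through [ys], at the interior point [0] of the interval
    from [-1] to [1]. *)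
Lemma sum_grad_minimizer p n (f : 'I_n -> 'cV[R]_p -> R) ys :
  (forall i y, differentiable (f i) y) ->
  (forall y, \sum_j f j ys <= \sum_j f j y) ->
  \sum_i grad (f i) ys = 0.
Proof.
move=> df ymin; apply/matrixP => k j; rewrite ord1 summxE !mxE.
pose v : 'cV[R]_p := delta_mx k 0.
under eq_bigr do rewrite mxE -/v.
rewrite -derive_sum; last by move=> i; exact: diff_derivable.
have dS (t : R) : is_derive t 1 (fun s : R => (\sum_i f i) (s *: v + ys))
    ('D_v (\sum_i f i) (t *: v + ys)).
  apply: is_derive_line; apply: derivableP; apply: derivable_sum => i.
  exact: diff_derivable.
have [| | |t|_ D0] := @derive1_at_min R (fun s : R => (\sum_i f i) (s *: v + ys))
    (-1) 1 0.
- by lra.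
- by move=> t _; exact: ex_derive.
- by rewrite in_itv /=; lra.
- by move=> _; rewrite !fct_sumE scale0r add0r; exact: ymin.
by have [_] := dS 0; rewrite D0 scale0r add0r => <-.
Qed.

(* The difference quotients of both sides coincide. *)
Lemma grad_separable_sum n d (f : 'I_n -> 'cV[R]_d -> R) x i j :
  grad (separable_sum f) x (mxtens_index (i, j)) 0 = grad (f i) (block x i) j 0.
Proof.
rewrite !mxE /derive.
set q := (X in lim (X @ _)); set q' := (X in _ = lim (X @ _)).
suff -> : q = q' by [].
apply/funext => h; rewrite {}/q {}/q' /=.
(* Moving coordinate [(i, j)] changes block [i] only, so all other summands cancel. *)
congr (_ *: _); rewrite /separable_sum -sumrB (bigD1 i)//= [X in _ + X]big1 ?addr0.
  congr (f i _ - _); apply/matrixP => k l; rewrite !mxE ord1 eqxx andbT.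
  congr (_ * _%:R + _); rewrite andbT; congr (nat_of_bool _).
  by rewrite (can_eq (@mxtens_indexK _ _)) xpair_eqE eqxx.
move=> k ki; rewrite [X in f k X](_ : _ = block x k) ?subrr//.
apply/matrixP => l l'; rewrite !mxE (can_eq (@mxtens_indexK _ _)) xpair_eqE.
by rewrite (negbTE ki) mulr0 add0r.
Qed.

End Gradients.
(** * Doubly stochastic matrices and their windows *)

Section Averaging.
Variables (R : realType) (n : nat).
Hypothesis n_gt0 : (0 < n)%N.
Local Notation J := (avg_mx R n).

Lemma avg_mxE i j : J i j = n%:R^-1.
Proof. by rewrite !mxE big_ord1 !mxE !mulr1. Qed.

Lemma doubly_stochastic_avg : doubly_stochastic J.
Proof.
have n_neq0 : n%:R != 0 :> R by rewrite pnatr_eq0 -lt0n.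
split=> [i j|i|j]; first by rewrite avg_mxE invr_ge0.
all: under eq_bigr do rewrite avg_mxE.
all: by rewrite sumr_const card_ord -[LHS]mulr_natl mulfV.
Qed.

Lemma mulmx_avg W : doubly_stochastic W -> W *m J = J.
Proof.
case=> _ rows _; apply/matrixP => i j; rewrite mxE avg_mxE.
under eq_bigr do rewrite avg_mxE.
by rewrite -mulr_suml rows mul1r.
Qed.

Lemma avg_mulmx W : doubly_stochastic W -> J *m W = J.
Proof.
case=> _ _ cols; apply/matrixP => i j; rewrite mxE avg_mxE.
under eq_bigr do rewrite avg_mxE.
by rewrite -mulr_sumr cols mulr1.
Qed.

(** Jensen's inequality: each row of [W] is a probability vector, so the square of a mean is at most
    the mean of the squares, the gap being a variance; summing over the rows uses the column
    sums. *)
Lemma doubly_stochastic_fnorm (W : 'M[R]_n) d (X : 'M[R]_(n, d)) :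
  doubly_stochastic W -> fnorm (W *m X) <= fnorm X.
Proof.
case=> W0 rows cols; rewrite -[leRHS]mul1r; apply: fnorm_mulmx_le => // v.
rewrite fnorm_le_sq// expr1n mul1r !fdotE !big_ord1.
apply: le_trans (_ : \sum_i \sum_k W i k * v k 0 ^+ 2 <= _); last first.
  rewrite exchange_big /=; apply: ler_sum => k _.
  by rewrite -mulr_suml cols mul1r expr2.
apply: ler_sum => i _; rewrite -expr2; set a := (W *m v) i 0.
have aE : \sum_k W i k * v k 0 = a by rewrite /a mxE.
rewrite -subr_ge0.
have -> : \sum_k W i k * v k 0 ^+ 2 - a ^+ 2 = \sum_k W i k * (v k 0 - a) ^+ 2.
  transitivity (\sum_k (W i k * v k 0 ^+ 2 - 2 * a * (W i k * v k 0)
                        + a ^+ 2 * W i k)); last first.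
    by apply: eq_bigr => k _; ring.
  by rewrite big_split sumrB/= -!mulr_sumr aE rows; ring.
by apply: sumr_ge0 => k _; rewrite mulr_ge0// sqr_ge0.
Qed.

Lemma fnorm_subr_avg d (X : 'M[R]_(n, d)) : fnorm (X - J *m X) <= 2 * fnorm X.
Proof.
rewrite (le_trans (fnormB _ _))// mulr_natl mulr2n lerD2l.
exact: doubly_stochastic_fnorm doubly_stochastic_avg.
Qed.

End Averaging.

(** * Transition products and a norm that contracts at every step *)

Section Windows.
Variables (R : realType) (n : nat) (W : nat -> 'M[R]_n).

(** The product [W (k + j - 1) ... W k], indexed by its oldest time. Peeling off the oldest factor
    matches the shift from [k] to [k.+1] in [window_norm_contract]. *)
Fixpoint trans_mx (k j : nat) : 'M[R]_n :=
  if j is j'.+1 then trans_mx k.+1 j' *m W k else 1%:M.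

Lemma trans_mxSl k j : trans_mx k j.+1 = W (k + j) *m trans_mx k j.
Proof.
elim: j k => [|j IHj] k; first by rewrite /= mulmx1 mul1mx addn0.
by rewrite -[LHS]/(trans_mx k.+1 j.+1 *m W k) IHj -mulmxA addSnnS.
Qed.

Lemma window_prod_trans_mx m k : window_prod W m (k + m).-1 = trans_mx k m.
Proof.
elim: m k => [|m IHm] k; first by rewrite /window_prod big_ord0.
rewrite trans_mxSl -IHm /window_prod big_ord_recl addnS /= subn0.
congr (_ *m _); apply: eq_bigr => i _; congr W.
by rewrite /bump /= add1n -subn1 -subnDA add1n.
Qed.

Hypothesis W_ds : forall k, doubly_stochastic (W k).

Lemma trans_mx_fnorm d (X : 'M[R]_(n, d)) k j :
  fnorm (trans_mx k j *m X) <= fnorm X.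
Proof.
elim: j => [|j IHj]; first by rewrite mul1mx.
rewrite trans_mxSl -mulmxA (le_trans _ IHj)//.
exact: doubly_stochastic_fnorm.
Qed.

(* A time-varying norm equivalent to [fnorm] that contracts at every step, as
   soon as [fnorm] contracts over windows of [m] steps. *)
Definition window_norm (m : nat) (rho : R) (k d : nat) (X : 'M[R]_(n, d)) : R :=
  \sum_(j < m) rho^-1 ^+ j * fnorm (trans_mx k j *m X).

Variables (m : nat) (rho : R).
Hypotheses (m_gt0 : (0 < m)%N) (rho_gt0 : 0 < rho).
Local Notation N := (window_norm m rho).

Let weight_ge0 j : 0 <= rho^-1 ^+ j.
Proof. by rewrite exprn_ge0// invr_ge0 ltW. Qed.

Lemma window_norm_ge k d (X : 'M[R]_(n, d)) : fnorm X <= N k X.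
Proof.
rewrite /window_norm; case: m m_gt0 => // m' _; rewrite big_ord_recl /= mul1mx.
by rewrite expr0 mul1r lerDl sumr_ge0// => j _; rewrite mulr_ge0 ?fnorm_ge0.
Qed.

Lemma window_norm_le k d (X : 'M[R]_(n, d)) :
  N k X <= (\sum_(j < m) rho^-1 ^+ j) * fnorm X.
Proof.
rewrite mulr_suml; apply: ler_sum => j _.
by rewrite ler_wpM2l// trans_mx_fnorm.
Qed.

Lemma window_normD k d (X Y : 'M[R]_(n, d)) : N k (X + Y) <= N k X + N k Y.
Proof.
rewrite -big_split; apply: ler_sum => j _ /=.
by rewrite -mulrDr mulmxDr ler_wpM2l// fnormD.
Qed.

(** Term [j] on the left is [rho] times term [j.+1] on the right-hand scale. The shifted sum thus
    loses the term [fnorm X] and gains the term of index [m], which the hypothesis bounds by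
    [fnorm X]. *)
Lemma window_norm_contract k d (X : 'M[R]_(n, d)) :
  fnorm (trans_mx k m *m X) <= rho ^+ m * fnorm X ->
  N k.+1 (W k *m X) <= rho * N k X.
Proof.
move=> H.
have -> : N k.+1 (W k *m X)
    = rho * \sum_(j < m) rho^-1 ^+ j.+1 * fnorm (trans_mx k j.+1 *m X).
  rewrite mulr_sumr; apply: eq_bigr => j _.
  by rewrite /= exprS mulmxA !mulrA mulfV ?gt_eqF// mul1r.
rewrite ler_pM2l// -(lerD2l (rho^-1 ^+ 0 * fnorm (trans_mx k 0 *m X))).
rewrite -(big_ord_recl m (fun j => rho^-1 ^+ j * fnorm (trans_mx k j *m X))).
rewrite big_ord_recr /= addrC lerD2r mul1mx expr0 mul1r.
by rewrite exprVn mulrC ler_pdivrMr ?exprn_gt0// mulrC.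
Qed.

End Windows.

(** * Scalar estimates: a per-step rate and the small-gain inequality *)

(** Bernoulli's inequality replaces an [m]-th root. Dividing by [m.+1] rather than [m] keeps [rho]
    positive even for [m = 1] and [delta = 0]. *)
Lemma exists_root_bound (R : realFieldType) (delta : R) m :
  (0 < m)%N -> 0 <= delta < 1 -> exists rho, 0 < rho < 1 /\ delta <= rho ^+ m.
Proof.
move=> m0 /andP[d0 d1]; pose x := (1 - delta) / m.+1%:R.
have mS : 0 < m.+1%:R :> R by rewrite ltr0n.
have x0 : 0 < x by rewrite divr_gt0// subr_gt0.
have x1 : x < 1.
  rewrite ltr_pdivrMr// mul1r (le_lt_trans (_ : _ <= 1))// ?ltr1n//.
  by rewrite gerBl.
exists (1 - x); split; first by apply/andP; split; lra.
have bernoulli k : 1 - k%:R * x <= (1 - x) ^+ k.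
  elim: k => [|k IHk]; first by rewrite mul0r subr0 expr0.
  rewrite exprS; apply: le_trans (ler_wpM2l _ IHk); last by lra.
  have : 0 <= k%:R * x ^+ 2 by rewrite mulr_ge0 ?sqr_ge0.
  by rewrite -natr1; lra.
apply: le_trans (bernoulli m).
have : m.+1%:R * x = 1 - delta by rewrite mulrC divfK ?gt_eqF.
by rewrite -natr1; lra.
Qed.
(* The consensus error [p] and the tracking error [q] contract at a rate that
   does not depend on the step-size [alpha], and the optimality error [r] at a
   rate [1 - alpha * mu]; every coupling is [O(alpha)] except [p -> q], and
   [r -> r] through the spread [eps] of the steps. Weighting [q] less than [p]
   and [p] less than [r] makes the combination contract for small [alpha]. *)
Lemma small_gain (R : realFieldType) (rho c mu alpha0 : R) :
  0 < rho < 1 -> 1 <= c -> 0 < mu -> 0 < alpha0 ->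
  exists eps alpha a b lambda : R,
    [/\ 0 < eps <= 1, 0 < alpha <= alpha0, 0 < a /\ 0 < b, 0 < lambda < 1 &
    forall p q r p' q' r', 0 <= p -> 0 <= q -> 0 <= r ->
      p' <= rho * p + c * alpha * (p + q + r) ->
      q' <= rho * q + c * p + c * alpha * (p + q + r) ->
      r' <= (1 - alpha * mu) * r + c * alpha * p
            + eps * alpha * c * (p + q + r) ->
      r' + a * p' + b * q' <= lambda * (r + a * p + b * q)].
Proof.
move=> /andP[rho0 rho1] c1 mu0 al0.
have c0 : 0 < c by lra.
(* With [a * c <= mu / 6], what the couplings feed into [r] is at most half of its margin
   [alpha * mu]. *)
pose a := Num.min 1 (mu / (6 * c)).
have a0 : 0 < a by rewrite lt_min ltr01 divr_gt0// mulr_gt0.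
have a1 : a <= 1 by rewrite ge_min lexx.
have ac : 6 * (a * c) <= mu.
  have : a <= mu / (6 * c) by rewrite ge_min lexx orbT.
  by rewrite ler_pdivlMr ?mulr_gt0//; lra.
(* The coupling from [p] to [q] then uses exactly one third of the margin [a * (1 - rho)] of [p]. *)
pose b := a * (1 - rho) / (3 * c).
have b0 : 0 < b by rewrite divr_gt0 ?mulr_gt0//; lra.
have bc : 3 * (b * c) = a * (1 - rho) by rewrite /b; field; lra.
have ba : 3 * b <= a.
  have : b <= b * c by rewrite ler_peMr// ltW.
  have : a * (1 - rho) <= a by rewrite ler_piMr//; lra.
  by lra.
(* The couplings of order [alpha] must fit into the smaller margin [b * (1 - rho)] of [q]. *)
pose alpha := Num.min alpha0 (b * (1 - rho) / (8 * c)).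
have alpha_gt0 : 0 < alpha.
  by rewrite lt_min al0 divr_gt0 ?(mulr_gt0 _ c0)// mulr_gt0// subr_gt0.
have alpha_le : alpha <= alpha0 by rewrite ge_min lexx.
have ca : 8 * (c * alpha) <= b * (1 - rho).
  have : alpha <= b * (1 - rho) / (8 * c) by rewrite ge_min lexx orbT.
  by rewrite ler_pdivlMr ?mulr_gt0//; lra.
(* The final rate [1 - th] keeps half of the margin of [r] and a third of those of [p] and [q]. *)
pose th := Num.min (alpha * mu / 2) ((1 - rho) / 3).
have th0 : 0 < th by rewrite lt_min !divr_gt0 ?mulr_gt0//; lra.
have th1 : th <= alpha * mu / 2 by rewrite ge_min lexx.
have th2 : th <= (1 - rho) / 3 by rewrite ge_min lexx orbT.
(* The spread [eps] is chosen equal to [a]; in [X] below one [a] comes from the spread, the other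
   from the weight of [p]. *)
exists a, alpha, a, b, (1 - th); split; rewrite ?a0 ?a1 ?alpha_gt0 ?alpha_le//.
  by apply/andP; split; lra.
move=> p q r p' q' r' p0 q0 r0 Hp Hq Hr.
pose X := c * alpha * (a + a + b).
have X_le : X <= c * alpha * (3 * a).
  by rewrite ler_wpM2l ?mulr_ge0//; lra.
have cr : 1 - alpha * mu + X <= 1 - th.
  have : alpha * (6 * (a * c)) <= alpha * mu by rewrite ler_pM2l.
  by lra.
have X2 : X <= 3 * (c * alpha).
  apply: le_trans X_le _.
  have : c * alpha * a <= c * alpha by rewrite ler_piMr ?mulr_ge0// ltW.
  by lra.
have tha : a * th <= a * ((1 - rho) / 3) by rewrite ler_pM2l.
have thb : b * th <= b * ((1 - rho) / 3) by rewrite ler_pM2l.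
have brho : 3 * (b * (1 - rho)) <= a * (1 - rho).
  by rewrite mulrA ler_wpM2r//; lra.
have brho0 : 0 <= b * (1 - rho) by rewrite mulr_ge0//; lra.
have cp : a * rho + b * c + c * alpha + X <= a * (1 - th) by lra.
have cq : b * rho + X <= b * (1 - th) by lra.
have Hp' := ler_wpM2l (ltW a0) Hp.
have Hq' := ler_wpM2l (ltW b0) Hq.
have Hcr := ler_wpM2r r0 cr.
have Hcp := ler_wpM2r p0 cp.
have Hcq := ler_wpM2r q0 cq.
apply: le_trans (_ : (1 - alpha * mu + X) * r
   + (a * rho + b * c + c * alpha + X) * p + (b * rho + X) * q <= _).
  by apply: le_trans (lerD (lerD Hr Hp') Hq') _; rewrite /X; lra.
by lra.
Qed.
(** * Gradient tracking in matrix form *)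

Section Reshape.
Variables (R : realType) (n d : nat).
Implicit Types x : 'cV[R]_(n * d).

(* On the [n x d] matrix whose rows are the blocks of [x], the operator
   [A (x) I_d] acts by left multiplication by [A]. *)
Definition unstack x : 'M[R]_(n, d) := \matrix_(i, j) x (mxtens_index (i, j)) 0.

Lemma sum_mxtens_index (F : 'I_(n * d) -> R) :
  \sum_l F l = \sum_i \sum_j F (mxtens_index (i, j)).
Proof.
rewrite pair_big /= (reindex (@mxtens_index n d)) /=.
  by apply: eq_bigr => -[].
by apply: onW_bij; exists (@mxtens_unindex n d);
  [exact: mxtens_indexK | exact: mxtens_unindexK].
Qed.

Lemma enorm_unstack x : enorm x = fnorm (unstack x).
Proof.
rewrite /enorm /fnorm sum_mxtens_index fdotE exchange_big; congr Num.sqrt.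
by apply: eq_bigr => i _; apply: eq_bigr => j _; rewrite !mxE -expr2.
Qed.

Lemma unstackB x x' : unstack (x - x') = unstack x - unstack x'.
Proof. by apply/matrixP => i j; rewrite !mxE. Qed.

Lemma unstackD x x' : unstack (x + x') = unstack x + unstack x'.
Proof. by apply/matrixP => i j; rewrite !mxE. Qed.

Lemma unstackZ a x : unstack (a *: x) = a *: unstack x.
Proof. by apply/matrixP => i j; rewrite !mxE. Qed.

Lemma unstack_kron (A : 'M[R]_n) x : unstack (kron_id d A *m x) = A *m unstack x.
Proof.
apply/matrixP => i j; rewrite !mxE sum_mxtens_index; apply: eq_bigr => k _.
rewrite (bigD1 j)//= big1 ?addr0 => [|l /negbTE lj].
  by rewrite tensmxE !mxE eqxx mulr1.
by rewrite tensmxE !mxE eq_sym lj mulr0 mul0r.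
Qed.

Lemma row_unstack x i : (row i (unstack x))^T = block x i.
Proof. by apply/matrixP => j k; rewrite !mxE. Qed.

End Reshape.

Lemma fnorm_tr (R : realType) p q (A : 'M[R]_(p, q)) : fnorm A^T = fnorm A.
Proof. by rewrite /fnorm fdot_tr. Qed.

Lemma fnorm_diag_mx (R : realType) p q (s : 'I_p -> R) (Z : 'M[R]_(p, q)) c :
  0 <= c -> (forall i, `|s i| <= c) ->
  fnorm (diag_mx (\row_i s i) *m Z) <= c * fnorm Z.
Proof.
move=> c0 sc; apply: fnorm_rows_le => // i.
have -> : row i (diag_mx (\row_i s i) *m Z) = s i *: row i Z.
  by apply/matrixP => k j; rewrite mul_diag_mx !mxE.
by rewrite fnormZ ler_wpM2r ?fnorm_ge0.
Qed.

(** * The stacked gradient and the mean gradient step *)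

Section GradientTracking.
Variables (R : realType) (n d : nat) (f : 'I_n -> 'cV[R]_d -> R).
Variables (mu L : 'I_n -> R) (ystar : 'cV[R]_d).
Hypothesis n_gt0 : (0 < n)%N.
Hypothesis grad_diff : forall i y, differentiable (grad (f i)) y.
Hypothesis muL : forall i, 0 <= mu i <= L i.
Hypothesis f_hess : forall i y, loewner_le (mu i)%:M (hess (f i) y) /\
                                loewner_le (hess (f i) y) (L i)%:M.
Hypothesis grad_ystar : \sum_i grad (f i) ystar = 0.

Local Notation J := (avg_mx R n).
Local Notation Ltot := (\sum_i L i).
Local Notation mutot := (\sum_i mu i).

Definition block_grad (X : 'M[R]_(n, d)) : 'M[R]_(n, d) :=
  \matrix_(i, j) grad (f i) (row i X)^T j 0.

Definition rows_const (y : 'cV[R]_d) : 'M[R]_(n, d) := \matrix_(i, j) y j 0.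

Local Notation G := block_grad.
Local Notation Xs := (rows_const ystar).

Lemma L_ge0 i : 0 <= L i.
Proof. by have /andP[m0 mL] := muL i; exact: le_trans mL. Qed.

Lemma Ltot_ge0 : 0 <= Ltot.
Proof. by apply: sumr_ge0 => i _; exact: L_ge0. Qed.

Lemma rows_const_row i y : row i (rows_const y) = y^T.
Proof. by apply/matrixP => k j; rewrite !mxE ord1. Qed.

Lemma rows_constB y z : rows_const y - rows_const z = rows_const (y - z).
Proof. by apply/matrixP => i j; rewrite !mxE. Qed.

Lemma rows_constZ a y : a *: rows_const y = rows_const (a *: y).
Proof. by apply/matrixP => i j; rewrite !mxE. Qed.

Lemma avg_mulmx_rows_const (X : 'M[R]_(n, d)) :
  J *m X = rows_const (n%:R^-1 *: \sum_i (row i X)^T).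
Proof.
apply/matrixP => i j; rewrite !mxE summxE mulr_sumr.
by apply: eq_bigr => k _; rewrite avg_mxE !mxE.
Qed.

Lemma avg_block_grad y :
  J *m G (rows_const y) = rows_const (n%:R^-1 *: \sum_i grad (f i) y).
Proof.
rewrite avg_mulmx_rows_const; congr (rows_const (_ *: _)).
apply: eq_bigr => i _; apply/matrixP => j k.
by rewrite 3!mxE rows_const_row trmxK (ord1 k).
Qed.

Lemma avg_block_grad_star : J *m G Xs = 0.
Proof.
by rewrite avg_block_grad grad_ystar scaler0; apply/matrixP => i j; rewrite !mxE.
Qed.

(** The rows decouple, and each [L i] is at most the sum of all of them, which serves as a common
    constant. *)
Lemma block_grad_lipschitz X Y : fnorm (G X - G Y) <= Ltot * fnorm (X - Y).
Proof.
apply: fnorm_rows_le => [|i]; first exact: Ltot_ge0.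
have rowG Z : row i (G Z) = (grad (f i) (row i Z)^T)^T.
  by apply/matrixP => k j; rewrite (ord1 k) [LHS]mxE [LHS]mxE [RHS]mxE.
rewrite [row i (G X - G Y)]linearB /= !rowG -linearB /= fnorm_tr.
apply: le_trans (grad_lipschitz (muL i) (grad_diff i) (f_hess i) _ _) _.
rewrite -linearB /= fnorm_tr [row i (X - Y)]linearB /= ler_wpM2r ?fnorm_ge0//.
by rewrite (bigD1 i)//= lerDl sumr_ge0// => j _; exact: L_ge0.
Qed.

(** On a matrix with equal rows this is, in each row, a gradient step of length [alpha / n] on the
    sum of the [f i], and [ystar] is a fixed point of that step. *)
Lemma mean_step_contraction alpha y : 0 <= alpha -> alpha * Ltot <= 1 ->
  fnorm (rows_const y - alpha *: (J *m G (rows_const y)) - Xs)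
    <= (1 - alpha * (mutot / n%:R)) * fnorm (rows_const y - Xs).
Proof.
move=> al0 alL.
have n1 : n%:R^-1 <= 1 :> R by rewrite invf_le1 ?ltr0n// ler1n.
have n0 : 0 <= n%:R^-1 :> R by rewrite invr_ge0.
have aL1 : alpha * n%:R^-1 * Ltot <= 1.
  rewrite mulrAC (le_trans _ alL)// ler_piMr// mulr_ge0//; exact: Ltot_ge0.
have muLtot : mutot <= Ltot.
  by apply: ler_sum => i _; have /andP[] := muL i.
have mu1 : 0 <= 1 - alpha * n%:R^-1 * mutot.
  rewrite subr_ge0 (le_trans _ aL1)// ler_wpM2l// mulr_ge0//.
have -> : alpha * (mutot / n%:R) = alpha * n%:R^-1 * mutot by ring.
have -> : rows_const y - alpha *: (J *m G (rows_const y)) - Xs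
    = rows_const ((y - (alpha * n%:R^-1) *: \sum_i grad (f i) y)
                - (ystar - (alpha * n%:R^-1) *: \sum_i grad (f i) ystar)).
  by rewrite avg_block_grad grad_ystar scaler0 subr0 rows_constZ !rows_constB scalerA.
rewrite rows_constB; apply: fnorm_rows_le => // i.
rewrite !rows_const_row !fnorm_tr.
by apply: (gradient_step_contraction grad_diff f_hess); rewrite ?mulr_ge0.
Qed.

(** * One iteration: recursions and bounds for the three errors *)

Section Step.
(** [C] is the [n x n] matrix through which [B^k] acts on the iterates; primes mark the next
    iterate. *)
Variables (W C : 'M[R]_n) (b alpha eps : R) (s : 'I_n -> R) (X U : 'M[R]_(n, d)).
Hypothesis W_ds : doubly_stochastic W.
Hypothesis C_avg : C *m J = b *: J.
Hypothesis C_bound : forall Z : 'M[R]_(n, d), fnorm (C *m Z) <= b * fnorm Z.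
Hypothesis alpha_gt0 : 0 < alpha.
Hypothesis alphaL : alpha * Ltot <= 1.
Hypothesis eps01 : 0 < eps <= 1.
Hypothesis s_bound : forall i, alpha <= s i <= alpha * (1 + eps).
Hypothesis U_avg : J *m U = 0.

Let Y := U + G X.
Let S := diag_mx (\row_i s i).
Let X' := W *m X - S *m Y.
Let U' := U + (W - 1%:M) *m (G X + U - C *m X).
Let Y' := U' + G X'.
Let P := X - J *m X.
Let Q := Y - J *m Y.
Let Rr := J *m X - Xs.
Let tot := fnorm P + fnorm Q + fnorm Rr.
Let Delta := G X' - G X.

Let J_ds : doubly_stochastic J := doubly_stochastic_avg R n_gt0.

Lemma avg_mix (Z : 'M[R]_(n, d)) : J *m ((W - 1%:M) *m Z) = 0.
Proof. by rewrite mulmxA mulmxBr mulmx1 (avg_mulmx W_ds) subrr mul0mx. Qed.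

Lemma mix_avg (Z : 'M[R]_(n, d)) : (W - 1%:M) *m (J *m Z) = 0.
Proof. by rewrite mulmxA mulmxBl mul1mx (mulmx_avg W_ds) subrr mul0mx. Qed.

(** The invariant of gradient tracking: it makes the mean of [Y] equal to the mean of the local
    gradients. *)
Lemma avg_tracker_step : J *m U' = 0.
Proof. by rewrite /U' mulmxDr U_avg avg_mix addr0. Qed.

Lemma consensus_error_step : X' - J *m X' = W *m P - (S *m Y - J *m (S *m Y)).
Proof.
rewrite /X' /P !mulmxBr !mulmxA (avg_mulmx W_ds) (mulmx_avg W_ds).
move: (W *m X) (J *m X) (S *m Y) (J *m S *m Y) => A1 A2 A3 A4.
by apply/matrixP => i j; rewrite !mxE; ring.
Qed.

(** [C] sends the mean part of [X] to a multiple of itself, which [W - 1] annihilates. *)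
Lemma mix_subr1 : (W - 1%:M) *m (C *m X) = (W - 1%:M) *m (C *m P).
Proof.
rewrite /P mulmxBr [in RHS]mulmxBr [C *m (J *m X)]mulmxA C_avg -scalemxAl.
by rewrite -scalemxAr mix_avg scaler0 subr0.
Qed.

Lemma tracking_error_step : Y' - J *m Y' =
  W *m Q + ((Delta - J *m Delta) - (W - 1%:M) *m (C *m P)).
Proof.
have -> : Y' = Y + ((W - 1%:M) *m Y - (W - 1%:M) *m (C *m P)) + Delta.
  rewrite -mix_subr1 -mulmxBr /Y' /U' /Delta /Y (addrC (G X) U).
  move: ((W - 1%:M) *m (U + G X - C *m X)) (G X') (G X) => A1 A2 A3.
  by apply/matrixP => i j; rewrite !mxE; ring.
rewrite [J *m (_ + Delta)]mulmxDr [J *m (Y + _)]mulmxDr [J *m (_ - _)]mulmxBr.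
rewrite !avg_mix /Q [W *m (_ - _)]mulmxBr [W *m (J *m Y)]mulmxA (mulmx_avg W_ds).
rewrite [(W - 1%:M) *m Y]mulmxBl mul1mx.
move: (W *m Y) (J *m Y) Y ((W - 1%:M) *m (C *m P)) Delta (J *m Delta).
move=> A1 A2 A3 A4 A5 A6.
by apply/matrixP => i j; rewrite !mxE; ring.
Qed.

(** Three pieces: an exact gradient step at the mean, the error of taking gradients at [X] instead
    of its mean, and the effect of unequal step-sizes. *)
Lemma optimality_error_step : J *m X' - Xs =
  (J *m X - alpha *: (J *m G (J *m X)) - Xs)
  - alpha *: (J *m (G X - G (J *m X)))
  - J *m (diag_mx (\row_i (s i - alpha)) *m Y).
Proof.
have -> : diag_mx (\row_i (s i - alpha)) *m Y = S *m Y - alpha *: Y.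
  apply/matrixP => i j; rewrite mul_diag_mx !mxE.
  rewrite (bigD1 i)//= big1 ?addr0 => [|k /negbTE ki].
    by rewrite !mxE eqxx mulrBl.
  by rewrite !mxE eq_sym ki mul0r.
have JY : J *m Y = J *m G X by rewrite /Y mulmxDr U_avg add0r.
rewrite /X' !mulmxBr -scalemxAr JY [J *m (W *m X)]mulmxA (avg_mulmx W_ds).
move: (J *m X) (J *m (S *m Y)) (J *m G X) (J *m G (J *m X)) => A1 A2 A3 A4.
by apply/matrixP => i j; rewrite !mxE; ring.
Qed.

Lemma X_dist_le : fnorm (X - Xs) <= fnorm P + fnorm Rr.
Proof.
have -> : X - Xs = P + Rr by rewrite /P /Rr addrA subrK.
exact: fnormD.
Qed.

(** The mean of the gradients vanishes at [Xs], so the mean of [Y] is controlled by the distance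
    from [X] to [Xs]. *)
Lemma tracker_le : fnorm Y <= (1 + Ltot) * tot.
Proof.
have JY : J *m Y = J *m (G X - G Xs).
  by rewrite /Y mulmxDr U_avg add0r mulmxBr avg_block_grad_star subr0.
have -> : Y = Q + J *m Y by rewrite /Q subrK.
apply: le_trans (fnormD _ _) _.
have H1 : fnorm (J *m Y) <= Ltot * (fnorm P + fnorm Rr).
  rewrite JY (le_trans (doubly_stochastic_fnorm _ J_ds))//.
  rewrite (le_trans (block_grad_lipschitz _ _))//.
  by rewrite ler_wpM2l ?Ltot_ge0// X_dist_le.
have := mulr_ge0 Ltot_ge0 (fnorm_ge0 Q).
have := fnorm_ge0 P; have := fnorm_ge0 Rr.
by rewrite /tot; lra.
Qed.

Lemma step_tracker_le : fnorm (S *m Y) <= 2 * alpha * fnorm Y.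
Proof.
have /andP[eps0 eps1] := eps01.
apply: fnorm_diag_mx => [|i]; first by rewrite mulr_ge0// ltW.
have /andP[s1 s2] := s_bound i.
have al0 := alpha_gt0.
have : alpha * eps <= alpha by rewrite ler_piMr// ltW.
by move=> ?; rewrite ger0_norm; lra.
Qed.

Lemma mix_sub_le (Z : 'M[R]_(n, d)) : fnorm ((W - 1%:M) *m Z) <= 2 * fnorm Z.
Proof.
rewrite mulmxBl mul1mx (le_trans (fnormB _ _))// mulr_natl mulr2n lerD2r.
exact: doubly_stochastic_fnorm.
Qed.

Lemma consensus_perturbation_le :
  fnorm (- (S *m Y - J *m (S *m Y))) <= 4 * (1 + Ltot) * alpha * tot.
Proof.
rewrite fnormN (le_trans (fnorm_subr_avg n_gt0 _))//.
have := ler_wpM2l (ltW alpha_gt0) tracker_le.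
by have := step_tracker_le; lra.
Qed.

(** [W - 1] annihilates the mean, so mixing moves [X] by an amount proportional to the consensus
    error. This part carries no factor [alpha], and it contributes to the coupling from [p] to [q]
    that is not small. *)
Lemma increment_le :
  fnorm (X' - X) <= 2 * fnorm P + 2 * (1 + Ltot) * alpha * tot.
Proof.
have -> : X' - X = (W - 1%:M) *m P - S *m Y.
  rewrite /X' /P mulmxBr !mulmxBl !mul1mx mulmxA (mulmx_avg W_ds) subrr subr0.
  by rewrite addrAC.
apply: le_trans (fnormB _ _) _.
have := ler_wpM2l (ltW alpha_gt0) tracker_le.
by have := step_tracker_le; have := mix_sub_le P; lra.
Qed.

Lemma tracking_perturbation_le :
  fnorm ((Delta - J *m Delta) - (W - 1%:M) *m (C *m P))
  <= (4 * Ltot + 2 * b) * fnorm P + 4 * Ltot * (1 + Ltot) * alpha * tot.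
Proof.
apply: le_trans (fnormB _ _) _.
have H1 := fnorm_subr_avg n_gt0 Delta.
have H2 := block_grad_lipschitz X' X.
have H3 := ler_wpM2l Ltot_ge0 increment_le.
have H4 := mix_sub_le (C *m P).
have H5 := C_bound P.
rewrite -/Delta in H2; lra.
Qed.

Lemma optimality_step_le : fnorm (J *m X' - Xs) <=
  (1 - alpha * (mutot / n%:R)) * fnorm Rr + Ltot * alpha * fnorm P
  + eps * alpha * (1 + Ltot) * tot.
Proof.
have al0 := ltW alpha_gt0.
have /andP[eps0 _] := eps01.
rewrite optimality_error_step.
apply: le_trans (fnormB _ _) _; apply: lerD; last first.
  rewrite (le_trans (doubly_stochastic_fnorm _ J_ds))//.
  (* Every step-size differs from [alpha] by at most [eps * alpha]. *)
  apply: le_trans (_ : eps * alpha * fnorm Y <= _).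
    apply: fnorm_diag_mx => [|i]; first by rewrite mulr_ge0// ltW.
    by have /andP[s1 s2] := s_bound i; rewrite ger0_norm; lra.
  rewrite -[leRHS]mulrA ler_wpM2l ?tracker_le// mulr_ge0// ltW//.
apply: le_trans (fnormB _ _) _; apply: lerD.
  by rewrite /Rr avg_mulmx_rows_const; exact: mean_step_contraction.
rewrite fnormZ ger0_norm// (mulrC Ltot) -mulrA ler_wpM2l//.
rewrite (le_trans (doubly_stochastic_fnorm _ J_ds))//.
exact: block_grad_lipschitz.
Qed.

End Step.

(** * Geometric decay of the weighted error *)

Lemma gradient_tracking_rate (W C : nat -> 'M[R]_n) (b rho : R) (m : nat) :
  (0 < m)%N -> 0 < rho < 1 -> 0 <= b -> 0 < mutot ->
  (forall k, doubly_stochastic (W k)) ->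
  (forall k (Z : 'M[R]_(n, d)), J *m Z = 0 ->
    fnorm (trans_mx W k m *m Z) <= rho ^+ m * fnorm Z) ->
  (forall k, C k *m J = b *: J) ->
  (forall k (Z : 'M[R]_(n, d)), fnorm (C k *m Z) <= b * fnorm Z) ->
  exists dmin dmax : R, 0 < dmin < dmax /\
    forall step : nat -> 'I_n -> R,
    (forall k i, dmin <= step k i <= dmax) ->
    forall X U : nat -> 'M[R]_(n, d), J *m U 0 = 0 ->
    (forall k, X k.+1 = W k *m X k
       - diag_mx (\row_i step k i) *m (U k + G (X k))) ->
    (forall k, U k.+1 = U k + (W k - 1%:M) *m (G (X k) + U k - C k *m X k)) ->
    exists c lambda : R, [/\ 0 <= c, 0 < lambda < 1 &
      forall k, fnorm (X k - Xs) <= c * lambda ^+ k].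
Proof.
move=> m_gt0 rho01 b0 mu_gt0 W_ds W_contr C_avg C_bound.
have /andP[rho0 rho1] := rho01.
have J_ds := doubly_stochastic_avg R n_gt0.
have L0 := Ltot_ge0.
have L_gt0 : 0 < Ltot.
  apply: lt_le_trans mu_gt0 _.
  by apply: ler_sum => i _; have /andP[] := muL i.
pose K := \sum_(j < m) rho^-1 ^+ j.
have K0 : 0 <= K by apply: sumr_ge0 => j _; rewrite exprn_ge0// invr_ge0 ltW.
have KL0 := mulr_ge0 K0 L0.
have KLL0 := mulr_ge0 KL0 L0.
have Kb0 := mulr_ge0 K0 b0.
(* One constant dominating every coupling; [K] converts the Frobenius norm of a perturbation into
   its window norm. *)
pose c := 1 + Ltot + 4 * K * (1 + Ltot) ^+ 2 + K * (4 * Ltot + 2 * b).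
have cE : c = 1 + Ltot + (4 * K + 8 * (K * Ltot) + 4 * (K * Ltot * Ltot))
              + (4 * (K * Ltot) + 2 * (K * b)) by rewrite /c; ring.
have c1 : 1 <= c by lra.
(* [Ltot^-1] caps [alpha], as the mean gradient step requires. *)
have al0 : 0 < Ltot^-1 by rewrite invr_gt0.
have mun : 0 < mutot / n%:R by rewrite divr_gt0// ltr0n.
have [eps [alpha [a [bb [lam [eps01 alpha_bnd [a0 bb0] lam01 gain]]]]]] :=
  small_gain rho01 c1 mun al0.
have /andP[alpha0 alphaL] := alpha_bnd.
have /andP[eps0 eps1] := eps01.
have /andP[lam0 lam1] := lam01.
have {}alphaL : alpha * Ltot <= 1 by rewrite -ler_pdivlMr// div1r.
exists alpha, (alpha * (1 + eps)); split.
  by rewrite alpha0 /= ltr_pMr// ltrDl.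
move=> step step_bnd X U U0 HX HU.
have JU k : J *m U k = 0.
  by elim: k => // k IHk; rewrite HU; exact: avg_tracker_step.
pose Y k := U k + G (X k).
pose P k := X k - J *m X k.
pose Q k := Y k - J *m Y k.
pose N k (Z : 'M[R]_(n, d)) := window_norm W m rho k Z.
pose p k := N k (P k); pose q k := N k (Q k).
pose r k := fnorm (J *m X k - Xs).
have avg0 (Z : 'M[R]_(n, d)) : J *m (Z - J *m Z) = 0.
  by rewrite mulmxBr mulmxA (mulmx_avg J_ds) subrr.
have N_ge k Z : fnorm Z <= N k Z by exact: window_norm_ge.
have N_step k Z E : J *m Z = 0 -> N k.+1 (W k *m Z + E) <= rho * N k Z + K * fnorm E.
  move=> JZ; apply: le_trans (window_normD _ _ rho0 _ _ _) _.
  apply: lerD; last exact: window_norm_le.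
  by apply: window_norm_contract => //; exact: W_contr.
have p0 k : 0 <= p k by exact: le_trans (fnorm_ge0 _) (N_ge _ _).
have q0 k : 0 <= q k by exact: le_trans (fnorm_ge0 _) (N_ge _ _).
have r0 k : 0 <= r k by exact: fnorm_ge0.
(* The Lyapunov function: consensus and tracking errors in the time-varying norm, the optimality
   error in the Frobenius norm, with the weights from [small_gain]. *)
pose V k := r k + a * p k + bb * q k.
have V_step k : V k.+1 <= lam * V k.
  pose tot := fnorm (P k) + fnorm (Q k) + r k.
  have tot_le : tot <= p k + q k + r k by rewrite lerD2r lerD ?N_ge.
  have al_tot : 0 <= alpha * (p k + q k + r k).
    by rewrite mulr_ge0 ?addr_ge0// ltW.
  have al_tot_le : alpha * tot <= alpha * (p k + q k + r k) by rewrite ler_pM2l.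
  have grow A : 0 <= A -> A <= c -> A * (alpha * tot) <= c * (alpha * (p k + q k + r k)).
    move=> A0 Ac; apply: le_trans (ler_wpM2l A0 al_tot_le) _.
    by rewrite ler_wpM2r.
  pose S := diag_mx (\row_i step k i).
  pose D := G (X k.+1) - G (X k).
  have XE : X k.+1 = W k *m X k - S *m Y k := HX k.
  have UE : U k.+1 = U k + (W k - 1%:M) *m (G (X k) + U k - C k *m X k) := HU k.
  have pE : P k.+1 = W k *m P k + - (S *m Y k - J *m (S *m Y k)).
    by rewrite /P XE; exact: (consensus_error_step (step k) (X k) (U k) (W_ds k)).
  have qE : Q k.+1
      = W k *m Q k + ((D - J *m D) - (W k - 1%:M) *m (C k *m P k)).
    rewrite /Q /Y /D UE XE.
    exact: (tracking_error_step (step k) (X k) (U k) (W_ds k) (C_avg k)).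
  have pert : fnorm (- (S *m Y k - J *m (S *m Y k))) <= 4 * (1 + Ltot) * alpha * tot.
    exact: (consensus_perturbation_le (X k) alpha0 eps01 (step_bnd k) (JU k)).
  have track : fnorm ((D - J *m D) - (W k - 1%:M) *m (C k *m P k))
      <= (4 * Ltot + 2 * b) * fnorm (P k) + 4 * Ltot * (1 + Ltot) * alpha * tot.
    rewrite /D XE.
    exact: (tracking_perturbation_le (X k) (W_ds k) (C_bound k) alpha0 eps01
      (step_bnd k) (JU k)).
  have opt : r k.+1 <= (1 - alpha * (mutot / n%:R)) * r k
      + Ltot * alpha * fnorm (P k) + eps * alpha * (1 + Ltot) * tot.
    rewrite /r XE.
    exact: (optimality_step_le (X k) (W_ds k) alpha0 alphaL eps01 (step_bnd k) (JU k)).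
  have Pp : fnorm (P k) <= p k := N_ge k (P k).
  clearbody tot S D; apply: gain => //.
  - rewrite [p k.+1]/p pE (le_trans (N_step _ _ _ (avg0 _)))// -/(p k) lerD2l.
    apply: le_trans (ler_wpM2l K0 pert) _.
    have H1 : 4 * K * (1 + Ltot) * (alpha * tot) <= c * (alpha * (p k + q k + r k)).
      by apply: grow; [rewrite !mulr_ge0// addr_ge0 | lra].
    by lra.
  - rewrite [q k.+1]/q qE (le_trans (N_step _ _ _ (avg0 _)))// -/(q k).
    rewrite -[leRHS]addrA lerD2l.
    apply: le_trans (ler_wpM2l K0 track) _.
    have H2 : (4 * (K * Ltot) + 2 * (K * b)) * fnorm (P k)
        <= (4 * (K * Ltot) + 2 * (K * b)) * p k by rewrite ler_wpM2l//; lra.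
    have H3 : (4 * (K * Ltot) + 2 * (K * b)) * p k <= c * p k.
      by rewrite ler_wpM2r//; lra.
    have H1 : 4 * (K * Ltot) * (1 + Ltot) * (alpha * tot)
        <= c * (alpha * (p k + q k + r k)).
      by apply: grow; [rewrite !mulr_ge0// addr_ge0 | lra].
    by lra.
  - apply: le_trans opt _; apply: lerD; first apply: lerD => //.
      rewrite mulrAC [leRHS]mulrAC; apply: ler_wpM2r; first exact: ltW.
      apply: le_trans (_ : Ltot * p k <= _); first by rewrite ler_wpM2l.
      by rewrite ler_wpM2r//; lra.
    have H1 : (1 + Ltot) * (alpha * tot) <= c * (alpha * (p k + q k + r k)).
      by apply: grow; [rewrite addr_ge0 | lra].
    by have := ler_wpM2l (ltW eps0) H1; lra.
have V_rate k : V k <= V 0%N * lam ^+ k.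
  elim: k => [|k IHk]; first by rewrite expr0 mulr1.
  apply: le_trans (V_step k) _; rewrite exprS mulrCA ler_pM2l//.
have V0 k : 0 <= V k by rewrite !addr_ge0// mulr_ge0// ltW.
(* The distance to [Xs] is at most [p k + r k], where [p k <= a^-1 * V k] and [r k <= V k]. *)
exists ((a^-1 + 1) * V 0%N), lam; split=> //.
  by rewrite mulr_ge0// addr_ge0// invr_ge0 ltW.
move=> k; apply: le_trans (X_dist_le _) _.
rewrite -mulrA; apply: le_trans (_ : (a^-1 + 1) * V k <= _); last first.
  by rewrite ler_wpM2l// addr_ge0// invr_ge0 ltW.
have : a^-1 * (a * p k) <= a^-1 * V k.
  apply: ler_wpM2l; first by rewrite invr_ge0 ltW.
  rewrite /V.
  by have := r0 k; have := mulr_ge0 (ltW bb0) (q0 k); lra.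
rewrite mulKf ?gt_eqF//.
have := N_ge k (P k); have := mulr_ge0 (ltW bb0) (q0 k).
have := mulr_ge0 (ltW a0) (p0 k).
by rewrite -/(P k) -/(r k) -/(p k) /V; lra.
Qed.

End GradientTracking.

(** * From the hypotheses to the matrix form *)

(** On matrices with zero column means, subtracting [avg_mx] from the window changes nothing, so its
    largest singular value bounds the action. *)
Lemma window_contraction (R : realType) n (W : nat -> 'M[R]_n) m :
  (0 < m)%N ->
  (ereal_sup [set (nu_max (window_prod W m k - avg_mx R n))%:E
             | k in [set k : nat | (m.-1 <= k)%N]] < 1)%E ->
  exists delta : R, 0 <= delta < 1 /\
    forall k d (Z : 'M[R]_(n, d)), avg_mx R n *m Z = 0 ->
      fnorm (trans_mx W k m *m Z) <= delta * fnorm Z.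
Proof.
move=> m_gt0; set s := ereal_sup _ => s_lt1.
have s_ub k : ((nu_max (trans_mx W k m - avg_mx R n))%:E <= s)%E.
  apply: ereal_sup_ubound; exists (k + m).-1; last by rewrite window_prod_trans_mx.
  by rewrite /= -!subn1 leq_sub2r// leq_addl.
(* The extended supremum is finite: the bound by [1] excludes [+oo], and any one window excludes
   [-oo]. *)
case: s s_lt1 s_ub => [s| |] s_lt1 s_ub; last 2 first.
- by move: s_lt1; rewrite ltNge leey.
- by have := s_ub 0%N; rewrite leNgt ltNyr.
exists (Num.max 0 s); split.
  by rewrite le_max lexx /= gt_max ltr01 -lte_fin.
move=> k d Z Z0.
have -> : trans_mx W k m *m Z = (trans_mx W k m - avg_mx R n) *m Z.
  by rewrite mulmxBl Z0 subr0.
apply: fnorm_mulmx_le => [|v]; first by rewrite le_max lexx.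
apply: le_trans (fnorm_nu_max _ _) _; rewrite ler_wpM2r ?fnorm_ge0//.
by have := s_ub k; rewrite lee_fin le_max => ->; rewrite orbT.
Qed.

(** The three choices become one: [B k] acts as [C k] on the blocks, with [C k] equal to [b *: W k],
    [b%:M] or [0], the last with [b = 0]. *)
Lemma kron_choice (R : realType) n d (W : nat -> 'M[R]_n)
    (B : nat -> 'M[R]_(n * d)) : (0 < n)%N ->
  (forall k, doubly_stochastic (W k)) ->
  (exists b : R, 0 < b /\ forall k, B k = b *: kron_id d (W k)) \/
  (exists b : R, 0 < b /\ forall k, B k = b%:M) \/
  (forall k, B k = 0) ->
  exists (C : nat -> 'M[R]_n) (b : R), [/\ 0 <= b,
    forall k x, unstack (B k *m x) = C k *m unstack x,
    forall k, C k *m avg_mx R n = b *: avg_mx R n &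
    forall k (Z : 'M[R]_(n, d)), fnorm (C k *m Z) <= b * fnorm Z].
Proof.
move=> n_gt0 W_ds [[b [b0 BE]]|[[b [b0 BE]]|BE]].
- exists (fun k => b *: W k), b; split=> [|k x|k|k Z]; first exact: ltW.
  + by rewrite BE -!scalemxAl unstackZ unstack_kron.
  + by rewrite -scalemxAl mulmx_avg.
  + rewrite -scalemxAl fnormZ gtr0_norm// ler_pM2l//.
    exact: doubly_stochastic_fnorm.
- exists (fun=> b%:M), b; split=> [|k x|k|k Z]; first exact: ltW.
  + by rewrite BE !mul_scalar_mx unstackZ.
  + by rewrite mul_scalar_mx.
  + by rewrite mul_scalar_mx fnormZ gtr0_norm.
- exists (fun=> 0), 0; split=> // [k x|k|k Z].
  + by rewrite BE !mul0mx; apply/matrixP => i j; rewrite !mxE.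
  + by rewrite mul0mx scale0r.
  + by rewrite mul0mx fnorm0 mul0r.
Qed.

Theorem theorem2 (R : realType) (n d : nat)
  (f : 'I_n -> 'cV[R]_d -> R) (mu L : 'I_n -> R)
  (f_C2 : forall i, twice_cont_diff (f i))
  (muL : forall i, 0 <= mu i <= L i)
  (f_hess : forall i y, loewner_le (mu i)%:M (hess (f i) y) /\
                        loewner_le (hess (f i) y) (L i)%:M)
  (mu_gt0 : 0 < \sum_(i < n) mu i)
  (ystar : 'cV[R]_d)
  (ystar_min : forall y, \sum_(j < n) f j ystar <= \sum_(j < n) f j y)
  (E : nat -> rel 'I_n) (W : nat -> 'M[R]_n)
  (W_ds : forall k, doubly_stochastic (W k))
  (W_E : forall k i j, i != j -> ~~ E k i j -> W k i j = 0)
  (m : nat) (m_gt0 : (0 < m)%N)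
  (W_window :
     (ereal_sup [set (nu_max (window_prod W m k - avg_mx R n))%:E
                | k in [set k : nat | (m.-1 <= k)%N]] < 1)%E)
  (B : nat -> 'M[R]_(n * d))
  (B_choice : (exists b : R, 0 < b /\ forall k, B k = b *: kron_id d (W k)) \/
              (exists b : R, 0 < b /\ forall k, B k = b%:M) \/
              (forall k, B k = 0)) :
  exists dmin dmax : R, 0 < dmin < dmax /\
    forall step : nat -> 'I_n -> R,
    (forall k i, dmin <= step k i <= dmax) ->
    forall (x0 : 'cV[R]_(n * d)) (x u : nat -> 'cV[R]_(n * d)),
    x 0%N = x0 -> u 0%N = 0 ->
    (forall k, x k.+1 = kron_id d (W k) *m x k
       - step_mx d (step k) *m (u k + grad (separable_sum f) (x k))) ->
    (forall k, u k.+1 = u k + (kron_id d (W k) - 1%:M)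
       *m (grad (separable_sum f) (x k) + u k - B k *m x k)) ->
    R_linear_cvg x (stack (fun _ => ystar)).
Proof.
(* An empty sum of the [mu i] could not be positive. *)
have n_gt0 : (0 < n)%N.
  by case: n mu mu_gt0 {f f_C2 muL L f_hess ystar_min E W W_ds W_E W_window B B_choice}
    => // mu0; rewrite big_ord0 ltxx.
have f_diff i y : differentiable (f i) y by have [] := f_C2 i.
have grad_diff i y : differentiable (grad (f i)) y by have [] := f_C2 i.
have grad_ystar := sum_grad_minimizer f_diff ystar_min.
have [delta [delta01 contr]] := window_contraction m_gt0 W_window.
have [rho [rho01 delta_rho]] := exists_root_bound m_gt0 delta01.
have [C [b [b0 BC C_avg C_bound]]] := kron_choice n_gt0 W_ds B_choice.
have W_contr k (Z : 'M[R]_(n, d)) : avg_mx R n *m Z = 0 ->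
    fnorm (trans_mx W k m *m Z) <= rho ^+ m * fnorm Z.
  by move=> /(contr k)/le_trans; apply; rewrite ler_wpM2r ?fnorm_ge0.
have [dmin [dmax [dmin_dmax rate]]] := gradient_tracking_rate n_gt0 grad_diff muL
  f_hess grad_ystar m_gt0 rho01 b0 mu_gt0 W_ds W_contr C_avg C_bound.
exists dmin, dmax; split=> // step step_bnd x0 x u _ u0 xS uS.
have gradE y : unstack (grad (separable_sum f) y) = block_grad f (unstack y).
  apply/matrixP => i j; rewrite [LHS]mxE [RHS]mxE row_unstack.
  exact: grad_separable_sum.
have [|k|k|c [lam [c0 lam01 bound]]] :=
  rate step step_bnd (fun k => unstack (x k)) (fun k => unstack (u k)).
- by rewrite u0; apply/matrixP => i j; rewrite !mxE big1// => k _; rewrite !mxE mulr0.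
- by rewrite xS unstackB !unstack_kron unstackD gradE.
- rewrite uS unstackD !mulmxBl !mul1mx !unstackB unstack_kron.
  by rewrite !unstackB !unstackD gradE BC.
exists c, lam; split=> // k; rewrite enorm_unstack unstackB.
have -> : unstack (stack (fun=> ystar)) = rows_const n ystar.
  by apply/matrixP => i j; rewrite !mxE mxtens_indexK.
exact: bound.
Qed.
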